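(* Consider the extended infinite horizon MPC closed loop (described in the context) with a general gain matrix $D_0$ (not necessarily regular) and any input horizon $m$. Assume that the spectral radius of $F$ is strictly smaller than $1$, and that the output reference $r$ is such that $r=D_0u_r$ for some $u_r\in\mathbb{U}$. Then the controller is stable, that is, for any $\eta>0$ there exists $\varepsilon>0$ such that $\|r\|\le\varepsilon$ implies $$\|e^*(0|k)\|\le\eta\quad\text{for all }k\ge 1 .$$ (Here all data of the controller other than $r$ are fixed, and $\varepsilon$ does not depend on $r$.)
   Context: $\|\cdot\|$ is the Euclidean norm. Model. Let $F\in\mathbb{C}^{n_d\times n_d}$, $D_0\in\mathbb{R}^{n_y\times n_u}$, $D_d\in\mathbb{C}^{n_d\times n_u}$, $\Psi\in\mathbb{R}^{n_y\times n_d}$. For discrete times $k\ge 0$ the system has static state $x_s\in\mathbb{R}^{n_y}$, dynamic state $x_d\in\mathbb{C}^{n_d}$, input $u\in\mathbb{R}^{n_u}$ and (real) output $y\in\mathbb{R}^{n_y}$, with $$x_s(k+1)=x_s(k)+D_0(u(k+1)-u(k)),\quad x_d(k+1)=Fx_d(k)+D_d(u(k+1)-u(k)),\quad y(k)=x_s(k)+\Psi x_d(k).$$ At time $0$: $u(0)=0$, $x_s(0)=0$, $x_d(0)=0$. Predictions. Let $m\ge 1$ be an integer (input horizon). At each time step $k\ge 1$, a sequence of moves $\Delta u_k=(\Delta u(0|k),\dots,\Delta u(m-1|k))\in(\mathbb{R}^{n_u})^m$ is considered, with $\Delta u(j|k)=0$ for $j\ge m$. Starting from the actual values $u(k-1)$,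 $x_s(k-1)$, $x_d(k-1)$ (assigned to index $j=-1$), the predictions for $j\ge 0$ are $$x_s(j|k)=x_s(j-1|k)+D_0\Delta u(j|k),\quad x_d(j|k)=Fx_d(j-1|k)+D_d\Delta u(j|k),\quad y(j|k)=x_s(j|k)+\Psi x_d(j|k),$$ and $u(j|k)=u(k-1)+\sum_{i=0}^{j}\Delta u(i|k)$. Optimization problem. Let $r\in\mathbb{R}^{n_y}$ be the output set-point, $e(j|k)=y(j|k)-r$, $\delta_k\in\mathbb{R}^{n_y}$ a slack vector, and let $Q\in\mathbb{R}^{n_y\times n_y}$, $R\in\mathbb{R}^{n_u\times n_u}$, $S\in\mathbb{R}^{n_y\times n_y}$ be positive definite. The cost is $$V_k=\sum_{j=0}^{\infty}[e(j|k)-\delta_k]^TQ[e(j|k)-\delta_k]+\sum_{j=0}^{m-1}\Delta u(j|k)^TR\,\Delta u(j|k)+\delta_k^TS\delta_k .$$ At each $k\ge 1$, $V_k$ is minimized over $(\Delta u_k,\delta_k)$ subject to $x_s(m-1|k)-\delta_k-r=0$, $u(k-1)+\sum_{j=0}^{i}\Delta u(j|k)\in\mathbb{U}$ for $0\le i<m$, and $\Delta u(j|k)\in\Delta\mathbb{U}$ for $0\le j<m$, where $\mathbb{U}$ and $\Delta\mathbb{U}$ are fixed rectangles in $\mathbb{R}^{n_u}$ containing the origin. The solution is unique; it is denoted $\Delta u_k^*,\delta_k^*$, the corresponding optimal cost is $V_k^*$, and starred quantities $u^*,x_s^*,x_d^*,y^*,e^*$ are the ones obtained from it. Closed loop. Only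 the first move is implemented: the actual input, state and output at time $k$ are $u(k)=u^*(0|k)=\sum_{\ell=1}^{k}\Delta u^*(0|\ell)$, $x_s(k)=x_s^*(0|k)$, $x_d(k)=x_d^*(0|k)$, $y(k)=y^*(0|k)$, and the problem is then solved again at time $k+1$. *)

(* Defs.v *)
From mathcomp Require Import all_boot all_order all_algebra.
From mathcomp Require Import all_classical all_reals all_analysis.
From mathcomp Require Import complex.

Set Implicit Arguments.
Unset Strict Implicit.
Unset Printing Implicit Defensive.

Import Order.TTheory GRing.Theory Num.Theory.

Local Open Scope classical_set_scope.
Local Open Scope ring_scope.
Local Open Scope complex_scope.

Section LinearAlgebra.
Variable R : realType.

(* The library norm on matrices is the max norm. *)
Definition enorm n (v : 'cV[R]_n) : R := Num.sqrt (\sum_(i < n) v i 0 ^+ 2).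

Definition qform n (A : 'M[R]_n) (v : 'cV[R]_n) : R := (v^T *m A *m v) 0 0.

Definition posdef n (A : 'M[R]_n) : Prop :=
  A^T = A /\ forall v : 'cV[R]_n, v != 0 -> 0 < qform A v.

(* [sup set0 = 0], so the value is 0 for the empty matrix. *)
Definition spectral_radius n (A : 'M[R[i]]_n) : R :=
  sup [set ComplexField.Normc.normc a | a in [set a : R[i] | eigenvalue A a]].

Definition toC m n (A : 'M[R]_(m, n)) : 'M[R[i]]_(m, n) :=
  map_mx (fun x : R => x%:C) A.

(* Sides may be open or closed, bounded or unbounded. *)
Definition rectangle n (I : 'I_n -> interval R) : set 'cV[R]_n :=
  [set v | forall i, v i 0 \in I i].

End LinearAlgebra.

Record plant (R : realType) (nd ny nu : nat) := Plant {
  Fmx : 'M[R[i]]_nd;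
  D0mx : 'M[R]_(ny, nu);
  Ddmx : 'M[R[i]]_(nd, nu);
  Psimx : 'M[R]_(ny, nd) }.

Record state (R : realType) (nd ny : nat) := State {
  xs : 'cV[R]_ny;
  xd : 'cV[R[i]]_nd }.

Section Plant.
Variables (R : realType) (nd ny nu : nat) (P : plant R nd ny nu).

Definition zero_state : state R nd ny := State 0 0.

Definition step (s : state R nd ny) (du : 'cV[R]_nu) : state R nd ny :=
  State (xs s + D0mx P *m du) (Fmx P *m xd s + Ddmx P *m toC du).

Definition complex_output (s : state R nd ny) : 'cV[R[i]]_ny :=
  toC (xs s) + toC (Psimx P) *m xd s.

Definition output (s : state R nd ny) : 'cV[R]_ny :=
  map_mx (@complex.Re R) (complex_output s).

Fixpoint trajectory (u : nat -> 'cV[R]_nu) (k : nat) : state R nd ny :=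
  if k is k'.+1 then step (trajectory u k') (u k'.+1 - u k') else zero_state.

(* The output of the complex model is real; [output] then loses nothing. *)
Definition real_output : Prop :=
  forall u : nat -> 'cV[R]_nu, u 0%N = 0 ->
  forall k, complex_output (trajectory u k) = toC (output (trajectory u k)).

End Plant.

Record controller (R : realType) (ny nu : nat) := Controller {
  Qmx : 'M[R]_ny;
  Rmx : 'M[R]_nu;
  Smx : 'M[R]_ny;
  Ubox : 'I_nu -> interval R;
  DUbox : 'I_nu -> interval R }.

Section MPC.
Variables (R : realType) (nd ny nu m : nat).
Variables (P : plant R nd ny nu) (C : controller R ny nu) (r : 'cV[R]_ny).

(* Below, [uprev] and [sprev] are u(k-1) and (x_s(k-1), x_d(k-1)). *)

Definition moves := 'I_m -> 'cV[R]_nu.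

(* Delta u(j|k), extended by 0 for j >= m. *)
Definition move (du : moves) (j : nat) : 'cV[R]_nu := oapp du 0 (insub j).

Fixpoint pred_state (sprev : state R nd ny) (du : moves) (j : nat) :
    state R nd ny :=
  step P (if j is j'.+1 then pred_state sprev du j' else sprev) (move du j).

Definition pred_input (uprev : 'cV[R]_nu) (du : moves) (j : nat) : 'cV[R]_nu :=
  uprev + \sum_(i < j.+1) move du i.

Definition pred_error (sprev : state R nd ny) (du : moves) (j : nat) :
    'cV[R]_ny :=
  output P (pred_state sprev du j) - r.

(* The series has nonnegative terms when Q is positive definite, so it is
   meaningful in the extended reals without a convergence assumption. *)
Definition cost (sprev : state R nd ny) (du : moves) (delta : 'cV[R]_ny) :
    \bar R :=
  (\sum_(0 <= j <oo) (qform (Qmx C) (pred_error sprev du j - delta))%:E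
   + (\sum_(j < m) qform (Rmx C) (du j))%:E + (qform (Smx C) delta)%:E)%E.

(* Meant for m >= 1: x_s(m-1|k) is the static state at [m.-1]. *)
Definition feasible (uprev : 'cV[R]_nu) (sprev : state R nd ny)
    (du : moves) (delta : 'cV[R]_ny) : Prop :=
  [/\ xs (pred_state sprev du m.-1) - delta - r = 0,
      forall i : nat, (i < m)%N -> rectangle (Ubox C) (pred_input uprev du i)
    & forall j : 'I_m, rectangle (DUbox C) (du j)].

Definition optimal (uprev : 'cV[R]_nu) (sprev : state R nd ny)
    (du : moves) (delta : 'cV[R]_ny) : Prop :=
  feasible uprev sprev du delta /\
  forall du' delta', feasible uprev sprev du' delta' ->
    (cost sprev du delta <= cost sprev du' delta')%E.

(* [du k] and [delta k] are the optimal solution at time k; their values at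
   k = 0 are irrelevant. *)
Definition closed_loop (u : nat -> 'cV[R]_nu) (s : nat -> state R nd ny)
    (du : nat -> moves) (delta : nat -> 'cV[R]_ny) : Prop :=
  [/\ u 0%N = 0, s 0%N = zero_state R nd ny
    & forall k : nat,
      [/\ optimal (u k) (s k) (du k.+1) (delta k.+1),
          u k.+1 = pred_input (u k) (du k.+1) 0
        & s k.+1 = pred_state (s k) (du k.+1) 0]].

End MPC.

(* Main.v *)
Require Import Defs.
From mathcomp Require Import all_boot all_order all_algebra.
From mathcomp Require Import all_classical all_reals all_analysis.
From mathcomp Require Import complex.
From mathcomp Require Import ring lra.

Set Implicit Arguments.
Unset Strict Implicit.
Unset Printing Implicit Defensive.

Import Order.TTheory GRing.Theory Num.Theory.

Local Open Scope classical_set_scope.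
Local Open Scope ring_scope.

(** The optimal cost is a Lyapunov function.  Moving nothing and letting the
    slack absorb the whole set-point is feasible at time 1 and costs
    [qform S r], because the plant is at rest and then every term but the
    slack penalty vanishes ([rest_candidate]).  At a later time, the tail of
    the previous optimal plan, completed by a null move and with the same
    slack, is feasible; it reproduces the previous predictions one step ahead,
    so that it costs the previous optimum minus nonnegative terms
    ([feasible_shift], [cost_shift_le]).  Hence the optimal cost never exceeds
    [qform S r] ([closed_loop_cost_le]).

    That cost dominates both [qform Q (e - delta)], where [e] is the current
    error, and [qform S delta].  A positive definite form is bounded below, and
    any quadratic form above, by a multiple of the squared Euclidean norm;
    therefore [enorm e] is at most a constant times [enorm r], and the constant
    depends on [Q] and [S] only. *)

(** * Quadratic forms and the Euclidean norm *)

Section QuadraticForms.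
Variables (R : realType) (n : nat).
Implicit Types (A : 'M[R]_n) (v w : 'cV[R]_n).

Lemma qform0 A : qform A 0 = 0.
Proof. by rewrite /qform mulmx0 mxE. Qed.

Lemma qformN A v : qform A (- v) = qform A v.
Proof.
by rewrite /qform mulmxN [(- v)^T]raddfN /= !mulNmx opprK.
Qed.

Lemma posdef_qform_ge0 A v : posdef A -> 0 <= qform A v.
Proof.
move=> [_ Apos]; have [->|/Apos/ltW //] := eqVneq v 0.
by rewrite qform0.
Qed.

Lemma posdef_unitmx A : posdef A -> A \in unitmx.
Proof.
move=> [_ Apos]; rewrite -unitmx_tr -row_free_unit -kermx_eq0.
apply: contraT => /rowV0Pn [v /sub_kermxP vA v_neq0].
have /Apos : v^T != 0 by rewrite trmx_eq0.
have -> : qform A v^T = 0.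
  by rewrite /qform trmxK -mulmxA -(trmxK A) -trmx_mul vA trmx0 mulmx0 mxE.
by rewrite ltxx.
Qed.

Definition bform A v w : R := (v^T *m A *m w) 0 0.

Lemma bform_sym A v w : A^T = A -> bform A v w = bform A w v.
Proof.
move=> Asym; rewrite /bform.
have -> : w^T *m A *m v = (v^T *m A *m w)^T.
  by rewrite !trmx_mul trmxK Asym mulmxA.
by rewrite [RHS]mxE.
Qed.

Lemma bform_line A u v w (t : R) :
  bform A u (v - t *: w) = bform A u v - t * bform A u w.
Proof.
by rewrite /bform mulmxBr -scalemxAr [LHS]mxE [X in _ + X]mxE [X in - X]mxE.
Qed.

Lemma qform_line A v w (t : R) : A^T = A ->
  qform A (v - t *: w) = qform A v - 2 * t * bform A w v + t ^+ 2 * qform A w.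
Proof.
move=> Asym; rewrite [LHS]bform_line (bform_sym _ v)// (bform_sym _ w)//.
rewrite !bform_line (bform_sym v w)//.
rewrite -[qform A v]/(bform A v v) -[qform A w]/(bform A w w); ring.
Qed.

Lemma posdef_CauchySchwarz A v w : posdef A ->
  bform A w v ^+ 2 <= qform A w * qform A v.
Proof.
move=> Apd; have [-> | w_neq0] := eqVneq w 0.
  by rewrite /bform trmx0 !mul0mx mxE expr0n qform0 mul0r.
have qw_gt0 := Apd.2 _ w_neq0.
set b := bform A w v.
(* [t = b / qform A w] is the minimizer of [qform A (v - t *: w)]. *)
have := posdef_qform_ge0 (v - (b / qform A w) *: w) Apd.
rewrite (qform_line _ _ _ Apd.1) -/b => line_ge0.
have := mulr_ge0 (ltW qw_gt0) line_ge0.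
have -> : qform A w * (qform A v - 2 * (b / qform A w) * b
            + (b / qform A w) ^+ 2 * qform A w)
          = qform A w * qform A v - b ^+ 2.
  by field; rewrite gt_eqF.
by rewrite subr_ge0.
Qed.

Lemma enorm_ge0 v : 0 <= enorm v.
Proof. exact: sqrtr_ge0. Qed.

Lemma sqr_enorm v : enorm v ^+ 2 = \sum_(i < n) v i 0 ^+ 2.
Proof. by rewrite sqr_sqrtr// sumr_ge0 // => i _; rewrite sqr_ge0. Qed.

(** Each coordinate of [v] is the [A]-inner product of [v] with a column of
    the inverse of [A], so Cauchy-Schwarz for this inner product bounds it. *)
Lemma posdef_coercive A : posdef A ->
  exists2 c : R, 0 <= c & forall v, enorm v ^+ 2 <= c * qform A v.
Proof.
move=> Apd; pose w i := invmx A *m delta_mx i 0 : 'cV[R]_n.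
exists (\sum_i qform A (w i)) => [|v].
  by apply: sumr_ge0 => i _; exact: posdef_qform_ge0.
rewrite sqr_enorm mulr_suml; apply: ler_sum => i _.
have -> : v i 0 = bform A (w i) v.
  rewrite /bform trmx_mul trmx_inv Apd.1 -!mulmxA mulKmx ?posdef_unitmx//.
  by rewrite trmx_delta -rowE mxE.
exact: posdef_CauchySchwarz.
Qed.

Lemma coord_le_enorm v i : `|v i 0| <= enorm v.
Proof.
rewrite -sqrtr_sqr ler_wsqrtr// (bigD1 i)//= lerDl.
by apply: sumr_ge0 => j _; rewrite sqr_ge0.
Qed.

Lemma qform_bounded A :
  exists2 c : R, 0 <= c & forall v, qform A v <= c * enorm v ^+ 2.
Proof.
exists (\sum_j \sum_i `|A i j|) => [|v].
  by apply: sumr_ge0 => j _; apply: sumr_ge0.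
rewrite /qform mxE mulr_suml; apply: ler_sum => j _.
rewrite mxE !mulr_suml; apply: ler_sum => i _.
rewrite mxE (le_trans (ler_norm _))// !normrM mulrAC mulrC expr2.
by rewrite ler_wpM2l// ler_pM// coord_le_enorm.
Qed.

Lemma sqr_enormD_le v w :
  enorm (v + w) ^+ 2 <= 2 * (enorm v ^+ 2 + enorm w ^+ 2).
Proof.
rewrite !sqr_enorm -big_split mulr_sumr; apply: ler_sum => i _ /=.
rewrite mxE -subr_ge0.
have -> : 2 * (v i 0 ^+ 2 + w i 0 ^+ 2) - (v i 0 + w i 0) ^+ 2
          = (v i 0 - w i 0) ^+ 2 by ring.
exact: sqr_ge0.
Qed.

End QuadraticForms.

(** * The optimal cost along the closed loop *)

Section Cost.
Variables (R : realType) (nd ny nu m : nat).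
Variables (P : plant R nd ny nu) (C : controller R ny nu) (r : 'cV[R]_ny).
Hypothesis m_gt0 : (0 < m)%N.
Hypotheses (Qpos : posdef (Qmx C)) (Rpos : posdef (Rmx C)).
Hypothesis Spos : posdef (Smx C).
Hypotheses (U0 : rectangle (Ubox C) 0) (DU0 : rectangle (DUbox C) 0).
Implicit Types (uprev : 'cV[R]_nu) (s : state R nd ny) (du : moves R nu m).
Implicit Type delta : 'cV[R]_ny.

Lemma move_ord du (j : 'I_m) : move du j = du j.
Proof. by rewrite /move valK. Qed.

Lemma move_default du j : (m <= j)%N -> move du j = 0.
Proof. by move=> m_le_j; rewrite /move insubF// ltnNge m_le_j. Qed.

(** [move] vanishes from index [m] on, so the last move of the shifted plan
    is null. *)
Definition shift du : moves R nu m := fun j => move du j.+1.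

Lemma move_shift du j : move (shift du) j = move du j.+1.
Proof.
have [j_lt_m | m_le_j] := ltnP j m; first by rewrite /move insubT.
by rewrite !move_default// ltnW.
Qed.

Lemma pred_state_shift s du j :
  pred_state P (pred_state P s du 0) (shift du) j = pred_state P s du j.+1.
Proof.
by elim: j => [|j IHj]; rewrite [LHS]/= move_shift // IHj.
Qed.

Lemma pred_input_shift uprev du j :
  pred_input (pred_input uprev du 0) (shift du) j = pred_input uprev du j.+1.
Proof.
rewrite /pred_input big_ord1 [in RHS]big_ord_recl addrA; congr (_ + _).
by apply: eq_bigr => i _; rewrite move_shift.
Qed.

Lemma pred_input_horizon uprev du :
  pred_input uprev du m = pred_input uprev du m.-1.
Proof.
by rewrite /pred_input big_ord_recr /= move_default// addr0 prednK.
Qed.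

(** After the horizon the static state and the input no longer change, so the
    constraints of the shifted plan at its last index repeat those of the
    original plan. *)
Lemma feasible_shift uprev s du delta :
  feasible P C r uprev s du delta ->
  feasible P C r (pred_input uprev du 0) (pred_state P s du 0) (shift du) delta.
Proof.
move=> [xs_end inU inDU]; split=> [|i i_lt_m|j].
- have xs_rest j : (m <= j.+1)%N ->
      xs (pred_state P s du j.+1) = xs (pred_state P s du j).
    by move=> m_le_j1; rewrite /= move_default// mulmx0 addr0.
  by rewrite pred_state_shift xs_rest ?prednK.
- rewrite pred_input_shift; move: i_lt_m; rewrite leq_eqVlt.
  case/predU1P => [->|]; last exact: inU.
  by rewrite pred_input_horizon; apply: inU; rewrite ltn_predL.
- rewrite /shift; have [j1_lt_m | m_le_j1] := ltnP j.+1 m.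
    by rewrite -[j.+1]/(val (Ordinal j1_lt_m)) move_ord.
  by rewrite move_default.
Qed.

Lemma stage_ge0 s du delta j :
  (0 <= (qform (Qmx C) (pred_error P r s du j - delta))%:E)%E.
Proof. by rewrite lee_fin posdef_qform_ge0. Qed.

Lemma moves_ge0 du : (0 <= \sum_(j < m) qform (Rmx C) (du j))%R.
Proof. by apply: sumr_ge0 => j _; exact: posdef_qform_ge0. Qed.

Lemma moves_shift_le du :
  \sum_(j < m) qform (Rmx C) (shift du j) <= \sum_(j < m) qform (Rmx C) (du j).
Proof.
under [leRHS]eq_bigr do rewrite -move_ord.
rewrite /shift; set f := fun j => qform (Rmx C) (move du j).
have -> : \sum_(j < m) f j.+1 = \sum_(1 <= j < m.+1) f j.
  by rewrite big_add1 big_mkord.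
rewrite big_nat_recr//= {2}/f move_default// qform0 addr0.
rewrite -(big_mkord xpredT f) [leRHS]big_ltn// lerDr.
exact: posdef_qform_ge0.
Qed.

(** What the shift drops is the first stage cost and the cost of the first
    move; the other terms are those of the original plan, reindexed. *)
Lemma cost_shift_le s du delta :
  (cost P C r (pred_state P s du 0) (shift du) delta <= cost P C r s du delta)%E.
Proof.
rewrite /cost; apply: leeD; last exact: lexx.
apply: leeD; last by rewrite lee_fin moves_shift_le.
rewrite [leRHS]nneseries_recl//; last by move=> j _; exact: stage_ge0.
rewrite -[in leRHS]nneseries_addn; last by move=> j; exact: stage_ge0.
under [in leRHS]eq_eseriesr do rewrite addn1.
under [leLHS]eq_eseriesr do rewrite /pred_error pred_state_shift.
by apply: leeDr; exact: stage_ge0.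
Qed.

Lemma stage0_le_cost s du delta :
  ((qform (Qmx C) (pred_error P r s du 0 - delta))%:E <= cost P C r s du delta)%E.
Proof.
rewrite /cost nneseries_recl//; last by move=> k _; exact: stage_ge0.
rewrite -2!addeA leeDl// adde_ge0//.
  by apply: nneseries_ge0 => k _ _; exact: stage_ge0.
by rewrite adde_ge0// lee_fin ?moves_ge0// posdef_qform_ge0.
Qed.

Lemma slack_le_cost s du delta :
  ((qform (Smx C) delta)%:E <= cost P C r s du delta)%E.
Proof.
rewrite /cost leeDr// adde_ge0//.
  by apply: nneseries_ge0 => k _ _; exact: stage_ge0.
by rewrite lee_fin moves_ge0.
Qed.

Definition no_moves : moves R nu m := fun=> 0.

Lemma move_no_moves j : move no_moves j = 0.
Proof. by rewrite /move; case: insub. Qed.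

Lemma toC0 p q : toC (0 : 'M[R]_(p, q)) = 0.
Proof. by apply/matrixP => i j; rewrite !mxE. Qed.

Lemma rest_state j :
  pred_state P (zero_state R nd ny) no_moves j = zero_state R nd ny.
Proof.
have step0 : step P (zero_state R nd ny) 0 = zero_state R nd ny.
  by rewrite /step toC0 /= !mulmx0 !addr0.
by elim: j => [|j IHj]; rewrite /= ?IHj move_no_moves step0.
Qed.

Lemma rest_candidate :
  feasible P C r 0 (zero_state R nd ny) no_moves (- r) /\
  cost P C r (zero_state R nd ny) no_moves (- r) = (qform (Smx C) r)%:E.
Proof.
split.
  split=> [|i _|j //]; first by rewrite rest_state /= sub0r opprK subrr.
  by rewrite /pred_input add0r big1// => j _; rewrite move_no_moves.
have output0 : output P (zero_state R nd ny) = 0.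
  rewrite /output /complex_output /= mulmx0 toC0 addr0.
  by apply/matrixP => i j; rewrite !mxE.
rewrite /cost eseries0; last first.
  by move=> j _ _; rewrite /pred_error rest_state output0 sub0r subrr qform0.
by rewrite big1 ?add0e ?qformN// => j _; rewrite qform0.
Qed.

Lemma closed_loop_cost_le (u : nat -> _) (s : nat -> _) (du : nat -> moves R nu m)
    (delta : nat -> _) :
  closed_loop P C r u s du delta ->
  forall k, (cost P C r (s k) (du k.+1) (delta k.+1) <= (qform (Smx C) r)%:E)%E.
Proof.
move=> [u0 s0 loop]; elim=> [|k IHk].
  have [[_ opt] _ _] := loop 0%N; move: opt; rewrite u0 s0 => opt.
  by have [feas <-] := rest_candidate; exact: opt.
have [[feas _] uS sS] := loop k; have [[_ opt] _ _] := loop k.+1.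
apply: le_trans IHk; apply: le_trans (cost_shift_le _ _ _); rewrite -sS.
by apply: opt; rewrite uS sS; exact: feasible_shift.
Qed.

End Cost.

(** * Stability *)

Theorem theorem2p4 (R : realType) (nd ny nu m : nat)
    (P : plant R nd ny nu) (C : controller R ny nu)
    (m_gt0 : (0 < m)%N)
    (Preal : real_output P)
    (Qpos : posdef (Qmx C)) (Rpos : posdef (Rmx C)) (Spos : posdef (Smx C))
    (U0 : rectangle (Ubox C) 0) (DU0 : rectangle (DUbox C) 0)
    (Fstable : spectral_radius (Fmx P) < 1) :
  forall eta : R, 0 < eta ->
  exists eps : R, 0 < eps /\
    forall r : 'cV[R]_ny,
      (exists ur : 'cV[R]_nu, rectangle (Ubox C) ur /\ r = D0mx P *m ur) ->
      enorm r <= eps ->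
    forall (u : nat -> 'cV[R]_nu) (s : nat -> state R nd ny)
      (du : nat -> moves R nu m) (delta : nat -> 'cV[R]_ny),
      closed_loop P C r u s du delta ->
    forall k : nat, (1 <= k)%N ->
      enorm (pred_error P r (s k.-1) (du k) 0) <= eta.
Proof.
move=> eta eta_gt0.
have [a a_ge0 aP] := posdef_coercive Qpos.
have [b b_ge0 bP] := posdef_coercive Spos.
have [c c_ge0 cP] := qform_bounded (Smx C).
pose K := 2 * (a + b) * c.
have K_ge0 : 0 <= K by rewrite !mulr_ge0// addr_ge0.
exists (eta / (1 + K)); split; first by rewrite divr_gt0// ltr_pwDl.
move=> r _ r_le u s du delta loop [//|k] _ /=.
have cost_le := closed_loop_cost_le m_gt0 Qpos Rpos U0 DU0 loop k.
set e := pred_error _ _ _ _ _.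
have stage_le : qform (Qmx C) (e - delta k.+1) <= qform (Smx C) r.
  rewrite -lee_fin; apply: le_trans cost_le.
  exact: (stage0_le_cost _ _ Qpos Rpos Spos).
have slack_le : qform (Smx C) (delta k.+1) <= qform (Smx C) r.
  rewrite -lee_fin; apply: le_trans cost_le.
  exact: (slack_le_cost _ _ Qpos Rpos).
have e_le : enorm e ^+ 2 <= K * enorm r ^+ 2.
  rewrite -{1}(subrK (delta k.+1) e); apply: (le_trans (sqr_enormD_le _ _)).
  rewrite /K -!mulrA ler_wpM2l//.
  apply: (@le_trans _ _ ((a + b) * qform (Smx C) r)); last first.
    by rewrite ler_wpM2l ?addr_ge0.
  rewrite mulrDl; apply: lerD.
    by apply: (le_trans (aP _)); exact: ler_wpM2l.
  by apply: (le_trans (bP _)); exact: ler_wpM2l.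
apply: (@le_trans _ _ ((1 + K) * enorm r)); last first.
  by rewrite mulrC -ler_pdivlMr// ltr_pwDl.
rewrite -(@ler_pXn2r _ 2)// ?nnegrE ?mulr_ge0 ?addr_ge0 ?enorm_ge0//.
by rewrite exprMn (le_trans e_le)// ler_wpM2r ?sqr_ge0//; nra.
Qed.
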